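(* Let $R$ be a ring. No nontrivial central idempotent of $R$ (that is, no central idempotent $e$ with $e \neq 0$ and $e \neq 1$) is a $\sqrt{\Delta}$-fine element of $R$. In particular, every abelian $\sqrt{\Delta}$-fine ring is indecomposable.
   Context: Rings are associative with identity, not necessarily commutative. For a ring $R$, $U(R)$ is its group of units. Define $\Delta(R) = \{a \in R : 1 - ua \in U(R) \text{ for every } u \in U(R)\}$ and $\sqrt{\Delta(R)} = \{x \in R : x^m \in \Delta(R) \text{ for some integer } m \ge 1\}$. A nonzero element $r \in R$ is called $\sqrt{\Delta}$-fine if $r = u + a$ for some $u \in U(R)$ and $a \in \sqrt{\Delta(R)}$. The ring $R$ is called $\sqrt{\Delta}$-fine if every nonzero element of $R$ is $\sqrt{\Delta}$-fine. A ring is abelian if all its idempotents are central. A ring is indecomposable if it is not isomorphic to a direct product of two nonzero rings, equivalently, if it has no central idempotents other than $0$ and $1$. *)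

(* Defs.v *)
From HB Require Import structures.
From mathcomp Require Import all_boot all_order all_algebra.

Set Implicit Arguments.
Unset Strict Implicit.
Unset Printing Implicit Defensive.

Import GRing.Theory.
Local Open Scope ring_scope.

(* Rings are [pzRingType]s: associative and unital, neither commutative nor
   nonzero in general. [GRing.unit] needs a [unitRingType], which is nonzero
   and carries a decision procedure for invertibility, so U(R) is defined
   directly; [is_unitE] shows the two agree where both make sense. *)
Definition is_unit (R : pzRingType) (x : R) : Prop :=
  exists y : R, x * y = 1 /\ y * x = 1.

Lemma is_unitE (R : unitRingType) (x : R) : is_unit x <-> x \is a GRing.unit.
Proof.
split=> [[y [xy yx]]|Ux]; first by apply/unitrP; exists y.
by exists x^-1; rewrite mulrV ?mulVr.
Qed.

Definition Delta (R : pzRingType) (a : R) : Prop :=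
  forall u : R, is_unit u -> is_unit (1 - u * a).

Definition sqrt_Delta (R : pzRingType) (x : R) : Prop :=
  exists m : nat, (1 <= m)%N /\ Delta (x ^+ m).

Definition sqrt_Delta_fine (R : pzRingType) (r : R) : Prop :=
  r <> 0 /\
  exists u a : R, [/\ is_unit u, sqrt_Delta a & r = u + a].

Definition sqrt_Delta_fine_ring (R : pzRingType) : Prop :=
  forall r : R, r <> 0 -> sqrt_Delta_fine r.

Definition is_idempotent (R : pzRingType) (e : R) : Prop := e * e = e.

Definition is_central (R : pzRingType) (x : R) : Prop :=
  forall y : R, GRing.comm x y.

Definition abelian_ring (R : pzRingType) : Prop :=
  forall e : R, is_idempotent e -> is_central e.

(* [nzRingType] is what makes both factors nonzero. *)
Definition indecomposable (R : pzRingType) : Prop :=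
  ~ exists (A B : nzRingType) (f : {rmorphism R -> (A * B)%type}), bijective f.

(* Main.v *)
Require Import Defs.
From HB Require Import structures.
From mathcomp Require Import all_boot all_order all_algebra.

Set Implicit Arguments.
Unset Strict Implicit.
Unset Printing Implicit Defensive.

Import GRing.Theory.
Local Open Scope ring_scope.

(** Write a central idempotent as e = u + a with u a unit and a ^ m in Delta(R),
    and put f = 1 - e. Since f e = 0, f a = - f u, hence f a ^ m = f (- u) ^ m.
    The element w = e + f (- u) ^ (- m) is a unit of R with f w a ^ m = f, so the
    unit 1 - w a ^ m is annihilated by f. Therefore f = 0, that is e = 1. *)

Lemma is_unitN (R : pzRingType) (x : R) : is_unit x -> is_unit (- x).
Proof. by case=> y [xy yx]; exists (- y); rewrite !mulrNN. Qed.

Lemma is_unitX (R : pzRingType) (x : R) n : is_unit x -> is_unit (x ^+ n).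
Proof.
case=> y [xy yx]; exists (y ^+ n).
have cxy : GRing.comm x y by rewrite /GRing.comm xy.
by rewrite -!exprMn_comm ?xy ?yx ?expr1n //; apply: commr_sym.
Qed.

(** Centrality carries [f] past each new [y] to the next factor, where [x] is again replaced by
    [y]. *)
Lemma central_mulX (R : pzRingType) (f x y : R) n :
  is_central f -> f * x = f * y -> f * x ^+ n = f * y ^+ n.
Proof.
move=> cf fxy; elim: n => [|n IHn]; first by rewrite !expr0.
by rewrite !exprS !mulrA fxy (cf y) -!mulrA IHn.
Qed.

Lemma is_central_compl (R : pzRingType) (e : R) :
  is_central e -> is_central (1 - e).
Proof. by move=> ce y; rewrite /GRing.comm mulrBl mulrBr mul1r mulr1 ce. Qed.

Lemma is_idempotent_compl (R : pzRingType) (e : R) :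
  is_idempotent e -> is_idempotent (1 - e).
Proof.
by rewrite /is_idempotent => ee; rewrite mulrBl mul1r mulrBr mulr1 ee subrr subr0.
Qed.

(** In the Peirce decomposition of [R] along [e], the element [e + (1 - e) * x] has components [e]
    and [(1 - e) * x], and products are taken componentwise. *)
Lemma mul_glue (R : pzRingType) (e x y : R) :
  is_idempotent e -> is_central e ->
  (e + (1 - e) * x) * (e + (1 - e) * y) = e + (1 - e) * (x * y).
Proof.
move=> ee ce; have cf := is_central_compl ce.
have ff := is_idempotent_compl ee.
have ef0 : e * (1 - e) = 0 by rewrite mulrBr mulr1 ee subrr.
rewrite mulrDl !mulrDr ee mulrA ef0 mul0r addr0.
(* Centrality brings [e] to the front of the remaining cross term, which then contains
   [e * (1 - e) = 0]. *)
rewrite -[_ * x * e](ce ((1 - e) * x)) [e * _]mulrA ef0 mul0r add0r.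
by rewrite -[_ * x * _]mulrA [x * _]mulrA -(cf x) !mulrA ff.
Qed.

Lemma is_unit_glue (R : pzRingType) (e x : R) :
  is_idempotent e -> is_central e -> is_unit x -> is_unit (e + (1 - e) * x).
Proof.
move=> ee ce [y [xy yx]]; exists (e + (1 - e) * y).
by rewrite !mul_glue // xy yx mulr1 addrC subrK.
Qed.

Lemma central_idempotent_fine_eq1 (R : pzRingType) (e : R) :
  is_idempotent e -> is_central e -> sqrt_Delta_fine e -> e = 1.
Proof.
move=> ee ce [_ [u [a [Uu [m [_ Da]] def_e]]]].
have cf := is_central_compl ce; have ff := is_idempotent_compl ee.
have fe0 : (1 - e) * e = 0 by rewrite mulrBl mul1r ee subrr.
have fa : (1 - e) * a = (1 - e) * - u.
  by apply/subr0_eq; rewrite -mulrBr opprK (addrC a) -def_e.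
have [v [uv vu]] : is_unit ((- u) ^+ m) by apply/is_unitX/is_unitN.
have Uv : is_unit v by exists ((- u) ^+ m).
have [z [wz _]] := Da _ (is_unit_glue ee ce Uv).
have fw : (1 - e) * (1 - (e + (1 - e) * v) * a ^+ m) = 0.
  (* With f = 1 - e, the glued unit acts on the f side as v, and f v a^m = v f a^m = v f (-u)^m = v
     (-u)^m f = f. *)
  rewrite mulrBr mulr1 mulrA mulrDr fe0 add0r mulrA ff (cf v) -mulrA.
  by rewrite (central_mulX m cf fa) (cf (_ ^+ m)) mulrA vu mul1r subrr.
by apply/esym/subr0_eq; rewrite -[LHS]mulr1 -[X in _ * X]wz mulrA fw mul0r.
Qed.

Theorem proposition2p8 :
  (forall (R : pzRingType) (e : R),
     is_idempotent e -> is_central e -> e <> 0 -> e <> 1 ->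
     ~ sqrt_Delta_fine e) /\
  (forall R : pzRingType,
     abelian_ring R -> sqrt_Delta_fine_ring R -> indecomposable R).
Proof.
split=> [R e ee ce _ e1 fe|R abR fineR [A [B [f [g fK gK]]]]].
  exact/e1/central_idempotent_fine_eq1.
(* The inverse [g] is only known as a map, so identities about [e] are checked after applying the
   injective morphism [f]. *)
pose e := g (1, 0).
have fe : f e = (1, 0) by rewrite gK.
have ee : is_idempotent e.
  by apply: (can_inj fK); rewrite rmorphM fe; congr pair; rewrite ?mulr1 ?mulr0.
have e0 : e <> 0.
  by move=> e0; move: fe; rewrite e0 rmorph0 => -[/esym/eqP]; rewrite oner_eq0.
have := central_idempotent_fine_eq1 ee (abR e ee) (fineR e e0).
(* Comparing second components gives [1 = 0] in the nonzero ring [B]. *)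
by move=> e1; move: fe; rewrite e1 rmorph1 => -[/eqP]; rewrite oner_eq0.
Qed.
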